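(* Suppose $P_1,P_2,P_4\in\mathbb{P}^2_{\mathbb{C}}$ are three points, that the formula \[ P_7=(P_1\times P_2)\,s_{14}s_{24}-s_{12}\,(P_1\times P_4)\,s_{24}+s_{12}s_{14}\,(P_2\times P_4) \] defines a point $P_7$, and that \[ P_3=(P_1\vee P_2)\cap(P_4\vee P_7),\qquad P_5=(P_1\vee P_4)\cap(P_2\vee P_7),\qquad P_6=(P_1\vee P_7)\cap(P_2\vee P_4). \] Then the points $P_1,\dots,P_7$ are in a $(C_8)$ configuration and are eigenpoints of a unique cubic of the plane. In particular, \[ \langle P_1\times P_2,P_3\times P_4\rangle=0,\qquad \langle P_1\times P_4,P_2\times P_5\rangle=0,\qquad \langle P_1\times P_6,P_2\times P_4\rangle=0 . \]
   Context: Work in $\mathbb{P}^2_{\mathbb{C}}$. For a ternary cubic form $f$, its eigenpoints are the points where the $2\times2$ minors of $\begin{pmatrix}x&y&z\\ \partial_xf&\partial_yf&\partial_zf\end{pmatrix}$ all vanish; a cubic of the plane is a nonzero ternary cubic form up to nonzero scalar. $\langle (A,B,C),(A',B',C')\rangle=AA'+BB'+CC'$, $s_{ij}=\langle P_i,P_j\rangle$ (computed on representing vectors), $\times$ is the cross product of representing vectors, and $P\vee Q$ is the line through distinct points $P,Q$. The formula for $P_7$ is a multihomogeneous expression in the coordinates of $P_1,P_2,P_4$, and it defines a point when it is nonzero. Seven points $P_1,\dots,P_7$ are in a $(C_8)$ configuration if the triples with indices $(1,2,3),(1,4,5),(1,6,7),(2,4,6),(2,5,7),(3,4,7)$ are 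aligned.
   Formalization: The three points P1, P2, P4 are additionally assumed not aligned; if they are aligned, P3=P4, P5=P2 and P6=P1 (or a line or intersection point is undefined) and the cubic is not unique, e.g. P1=(1,0,0), P2=(1,1,0), P4=(1,2,0). *)

(* Defs.v *)
From HB Require Import structures.
From mathcomp Require Export all_boot all_order all_algebra.
From mathcomp Require Export reals.
From mathcomp Require Export complex.
From mathcomp Require Export mpoly.

Set Implicit Arguments.
Unset Strict Implicit.
Unset Printing Implicit Defensive.

Import GRing.Theory.
Local Open Scope ring_scope.

(* A point of the projective plane over K is given by a nonzero row vector u;
   u and v represent the same point when their row spaces agree, u :=: v.
   The line through two points is then the row space of (u + v)%MS, and the
   intersection of two lines is their (_ :&: _)%MS. *)
Section Plane.

Variable K : fieldType.
Implicit Types u v w : 'rV[K]_3.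

(* The symmetric bilinear form, without conjugation. *)
Definition dot u v : K := \sum_(i < 3) u 0 i * v 0 i.

(* Indices are added in 'I_3, that is modulo 3. *)
Definition cross u v : 'rV[K]_3 :=
  \row_(i < 3) (u 0 (i + 1) * v 0 (i + 2%:R) - u 0 (i + 2%:R) * v 0 (i + 1)).

Definition aligned u v w : Prop := (\rank (u + v + w) <= 2)%N.

Definition C8_configuration (P1 P2 P3 P4 P5 P6 P7 : 'rV[K]_3) : Prop :=
  [/\ aligned P1 P2 P3, aligned P1 P4 P5 & aligned P1 P6 P7] /\
  [/\ aligned P2 P4 P6, aligned P2 P5 P7 & aligned P3 P4 P7].

Definition cubic (f : {mpoly K[3]}) : Prop := f != 0 /\ f \is 3.-homog.

Definition gradient (f : {mpoly K[3]}) u : 'rV[K]_3 :=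
  \row_(i < 3) (f^`M(i)).@[u 0].

(* The 2 x 2 minors are selected by maps h of column indices; the minors for
   non-injective h vanish. *)
Definition eigenpoint (f : {mpoly K[3]}) u : Prop :=
  forall h : 'I_2 -> 'I_3, \det (colsub h (col_mx u (gradient f u))) = 0.

Definition P7_formula (P1 P2 P4 : 'rV[K]_3) : 'rV[K]_3 :=
  let s12 := dot P1 P2 in
  let s14 := dot P1 P4 in
  let s24 := dot P2 P4 in
  (s14 * s24) *: cross P1 P2 - (s12 * s24) *: cross P1 P4
    + (s12 * s14) *: cross P2 P4.

End Plane.

(* Main.v *)
(* Let p = s24, q = s14, r = s12, and D = det (P1, P2, P4).  In the basis
   a = P1, b = P2, c = P4 the point n = P7 / D = al a + be b + ga c is
   characterised by <n, a> = q r, <n, b> = p r, <n, c> = p q, and up to scaling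
   P3 = al a + be b, P5 = al a + ga c, P6 = be b + ga c.  Polarise a cubic into
   its symmetric trilinear form T.  That a, b, c are eigenpoints means
   T(a, a, .) = la <a, .> and likewise for lb, lc, so an eigencubic is given by
   la, lb, lc and t = T(a, b, c).  The point P3 then yields the relation
   r (al la + be lb) = (r - ga) t, and P5, P6 its analogues.  These relations
   leave at most one cubic up to scaling, because at most one of p, q, r is zero
   and nondegeneracy forces al, be, ga <> 0.  Conversely
   la = p <a, a> + q r, lb = q <b, b> + p r, lc = r <c, c> + p q, t = 2 p q r
   satisfies the eigenpoint conditions at all seven points. *)
From mathcomp Require Import ring.
Require Import Defs.
Import GRing.Theory Num.Theory.
Local Open Scope ring_scope.
Set Implicit Arguments.
Unset Strict Implicit.
Unset Printing Implicit Defensive.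

(** Serves to conclude from an explicit linear combination of known equalities: once the combination
    is supplied as [x = y], the remaining goal is a polynomial identity for [ring]. *)
Lemma eq_of_subr_eq (V : zmodType) (x y z t : V) :
  x = y -> z - t = x - y -> z = t.
Proof. by move=> -> /eqP; rewrite subrr subr_eq0 => /eqP. Qed.

(** * Euler's identity for homogeneous polynomials *)

Section Euler.

Variables (n : nat) (K : comNzRingType).
Implicit Types (p : {mpoly K[n]}) (d : nat).

Lemma mderiv_mulX (m : 'X_{1..n}) i :
  'X_i * 'X_[m]^`M(i) = (m i)%:R *: ('X_[m] : {mpoly K[n]}).
Proof.
rewrite mderivX -scalerAr; have [->|mi] := eqVneq (m i) 0%N.
  by rewrite !scale0r.
by rewrite -mpolyXD addmC submK // lep1mP.
Qed.

Lemma dhomog_mderiv d p i : p \is d.+1.-homog -> p^`M(i) \is d.-homog.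
Proof.
move=> /dhomogP hp; rewrite [p]mpolyE raddf_sum big_seq rpred_sum // => m /hp.
rewrite /= mderivZ mderivX => deg_m; apply: dhomogZ.
have [->|mi] := eqVneq (m i) 0%N; first by rewrite scale0r dhomog0.
apply: dhomogZ; rewrite dhomogX /= -eqSS -deg_m.
have /submK {2}<- : (U_(i) <= m)%MM by rewrite lep1mP.
by rewrite mdegD mdeg1 addn1.
Qed.

(** By linearity only monomials matter; on a monomial, ['X_i] times the i-th derivative multiplies
    by the i-th exponent, and the exponents sum to [d]. *)
Lemma euler_mderiv d p :
  p \is d.-homog -> \sum_i 'X_i * p^`M(i) = d%:R *: p.
Proof.
move=> /dhomogP hp; rewrite [p]mpolyE scaler_sumr.
under eq_bigr do rewrite raddf_sum mulr_sumr.
rewrite exchange_big big_seq [RHS]big_seq /=; apply: eq_bigr => m /hp /= deg_m.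
under eq_bigr do rewrite mderivZ -scalerAr mderiv_mulX scalerA.
rewrite -scaler_suml -mulr_sumr -natr_sum -mdegE deg_m scalerA.
by rewrite mulrC.
Qed.

End Euler.

(** * Polarisation of ternary cubics *)

Section Polar.

Variable K : numFieldType.
Implicit Types (f g : {mpoly K[3]}) (u v w : 'rV[K]_3).

(** For a cubic form the third derivatives are constants, so the coefficient at [0%MM] is their full
    value. This is 6 times the classical polarisation: at (u, u, u) it gives 6 f(u). *)
Definition polar f u v w : K :=
  \sum_i \sum_j \sum_k u 0 i * v 0 j * w 0 k
    * f^`M(i)^`M(j)^`M(k)@_0%MM.

Lemma polarC12 f u v w : polar f u v w = polar f v u w.
Proof.
rewrite /polar exchange_big /=; apply: eq_bigr => j _; apply: eq_bigr => i _.
by apply: eq_bigr => k _; rewrite (mderiv_comm i j) (mulrC (u 0 i)).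
Qed.

Lemma polarC23 f u v w : polar f u v w = polar f u w v.
Proof.
rewrite /polar; apply: eq_bigr => i _; rewrite exchange_big /=.
apply: eq_bigr => j _; apply: eq_bigr => k _.
by rewrite (mderiv_comm j k) (mulrAC (u 0 i)).
Qed.

Lemma polarDl f u1 u2 v w :
  polar f (u1 + u2) v w = polar f u1 v w + polar f u2 v w.
Proof.
rewrite /polar -big_split; apply: eq_bigr => i _ /=.
rewrite -big_split; apply: eq_bigr => j _ /=.
by rewrite -big_split; apply: eq_bigr => k _ /=; rewrite !mxE !mulrDl.
Qed.

Lemma polarZl f a u v w : polar f (a *: u) v w = a * polar f u v w.
Proof.
rewrite /polar mulr_sumr; apply: eq_bigr => i _.
rewrite mulr_sumr; apply: eq_bigr => j _.
by rewrite mulr_sumr; apply: eq_bigr => k _; rewrite !mxE !mulrA.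
Qed.

Lemma polarDm f u v1 v2 w :
  polar f u (v1 + v2) w = polar f u v1 w + polar f u v2 w.
Proof. by rewrite polarC12 polarDl !(polarC12 f u). Qed.

Lemma polarZm f a u v w : polar f u (a *: v) w = a * polar f u v w.
Proof. by rewrite polarC12 polarZl (polarC12 f u). Qed.

Lemma polarDr f u v w1 w2 :
  polar f u v (w1 + w2) = polar f u v w1 + polar f u v w2.
Proof. by rewrite polarC23 polarDm !(polarC23 f u v). Qed.

Lemma polarZr f a u v w : polar f u v (a *: w) = a * polar f u v w.
Proof. by rewrite polarC23 polarZm (polarC23 f u v). Qed.

Lemma polar_sub f g (a : K) u v w :
  polar (f - a *: g) u v w = polar f u v w - a * polar g u v w.
Proof.
rewrite /polar mulr_sumr -sumrB; apply: eq_bigr => i _.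
rewrite mulr_sumr -sumrB; apply: eq_bigr => j _.
rewrite mulr_sumr -sumrB; apply: eq_bigr => k _.
by rewrite !(mderivB, mderivZ) mcoeffB mcoeffZ; ring.
Qed.

Lemma meval_euler d f u : f \is d.-homog ->
  d%:R * f.@[u 0] = \sum_i u 0 i * (f^`M(i)).@[u 0].
Proof.
move=> /euler_mderiv; move=> /(congr1 (meval (u 0))).
rewrite raddf_sum mevalZ => <-.
by apply: eq_bigr => i _ /=; rewrite mevalM mevalXU.
Qed.

Lemma dhomog0_meval f u : f \is 0.-homog -> f.@[u 0] = f@_0%MM.
Proof.
move=> /dhomogP hf; suff -> : f = (f@_0%MM)%:MP.
  by rewrite mevalC mcoeffC eqxx mulr1.
apply/mpolyP => m; rewrite mcoeffC; have [<-|m0] := eqVneq 0%MM m.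
  by rewrite mulr1.
rewrite mulr0; apply/eqP; rewrite mcoeff_eq0; apply/negP => /hf /eqP /=.
by rewrite mdeg_eq0 eq_sym (negbTE m0).
Qed.

(** Euler's identity is applied to the first derivatives, of degree 2, and then to the second ones,
    of degree 1; the factor 2 is the degree of the former. *)
Lemma dot_gradient f u w : f \is 3.-homog ->
  2 * dot (gradient f u) w = polar f u u w.
Proof.
move=> hf; rewrite polarC23 polarC12 /polar /dot mulr_sumr.
apply: eq_bigr => i _; rewrite mxE.
have hi := dhomog_mderiv i hf; rewrite mulrA (meval_euler u hi) mulr_suml.
apply: eq_bigr => j _; have hj := dhomog_mderiv j hi.
rewrite -[X in _ * X * _]mul1r (meval_euler u hj) mulr_sumr mulr_suml.
apply: eq_bigr => k _; rewrite (dhomog0_meval u (dhomog_mderiv k hj)); ring.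
Qed.

Lemma mderiv_inj0 d f : f \is d.+1.-homog -> (forall i, f^`M(i) = 0) -> f = 0.
Proof.
move=> /euler_mderiv hf f0; apply/eqP.
have /eqP := hf; rewrite big1 => [|i _]; last by rewrite f0 mulr0.
by rewrite eq_sym scaler_eq0 pnatr_eq0.
Qed.

(** In characteristic zero a form of positive degree with zero partial derivatives is zero. Three
    descents lead to the constant third derivatives, which are the values of the polar form on
    standard basis vectors. *)
Lemma polar_inj0 f :
  f \is 3.-homog -> (forall u v w, polar f u v w = 0) -> f = 0.
Proof.
move=> hf f0; apply: (mderiv_inj0 hf) => i; have hi := dhomog_mderiv i hf.
apply: (mderiv_inj0 hi) => j; have hj := dhomog_mderiv j hi.
apply: (mderiv_inj0 hj) => k; have /dhomogP hk := dhomog_mderiv k hj.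
apply/mpolyP => m; rewrite mcoeff0; have [->|m0] := eqVneq m 0%MM; last first.
  apply/eqP; rewrite mcoeff_eq0; apply/negP => /hk /eqP /=.
  by rewrite mdeg_eq0 (negbTE m0).
have := f0 (delta_mx 0 i) (delta_mx 0 j) (delta_mx 0 k).
rewrite /polar (bigD1 i) //= (bigD1 j) //= (bigD1 k) //=.
rewrite !big1 ?addr0 => [|i' /negbTE i'N|j' /negbTE j'N|k' /negbTE k'N].
- by rewrite !mxE !eqxx !mul1r.
- by rewrite big1 // => ? _; rewrite big1 // => ? _; rewrite !mxE i'N !mul0r.
- by rewrite big1 // => ? _; rewrite !mxE j'N mulr0 !mul0r.
- by rewrite !mxE k'N mulr0 !mul0r.
Qed.

End Polar.

(** * Dot and cross products, and alignment *)

Section CrossProduct.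

Variable K : fieldType.
Implicit Types (u v w x y : 'rV[K]_3) (k : K).

Lemma row3P u v :
  u 0 0 = v 0 0 -> u 0 1 = v 0 1 -> u 0 2%:R = v 0 2%:R -> u = v.
Proof.
move=> e0 e1 e2; apply/rowP => i; case: i => [[|[|[|//]]] lt_i].
- by rewrite (_ : Ordinal _ = 0) //; apply: val_inj.
- by rewrite (_ : Ordinal _ = 1) //; apply: val_inj.
- by rewrite (_ : Ordinal _ = 2%:R) //; apply: val_inj.
Qed.

Lemma dotE u v :
  dot u v = u 0 0 * v 0 0 + u 0 1 * v 0 1 + u 0 2%:R * v 0 2%:R.
Proof.
rewrite /dot !big_ord_recr big_ord0 /= add0r.
by congr (_ * _ + _ * _ + _ * _); congr (_ _ _); apply: val_inj.
Qed.

Lemma crossE u v :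
  [/\ cross u v 0 0 = u 0 1 * v 0 2%:R - u 0 2%:R * v 0 1,
      cross u v 0 1 = u 0 2%:R * v 0 0 - u 0 0 * v 0 2%:R
    & cross u v 0 2%:R = u 0 0 * v 0 1 - u 0 1 * v 0 0].
Proof.
by split; rewrite mxE; congr (_ * _ - _ * _); congr (_ _ _); apply: val_inj.
Qed.

Lemma dotC u v : dot u v = dot v u.
Proof. by rewrite !dotE; ring. Qed.

Lemma dotDl u v w : dot (u + v) w = dot u w + dot v w.
Proof. by rewrite !dotE !mxE; ring. Qed.

Lemma dotZl k u v : dot (k *: u) v = k * dot u v.
Proof. by rewrite !dotE !mxE; ring. Qed.

Lemma dot0 u : dot 0 u = 0.
Proof. by rewrite dotE !mxE; ring. Qed.

Lemma dotN u v : dot (- u) v = - dot u v.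
Proof. by rewrite -scaleN1r dotZl mulN1r. Qed.

Lemma dotDr u v w : dot u (v + w) = dot u v + dot u w.
Proof. by rewrite !(dotC u) dotDl. Qed.

Lemma dotZr k u v : dot u (k *: v) = k * dot u v.
Proof. by rewrite !(dotC u) dotZl. Qed.

Lemma dot_delta u i : dot u (delta_mx 0 i) = u 0 i.
Proof.
rewrite /dot (bigD1 i) //= big1 => [|j /negbTE jN].
  by rewrite mxE !eqxx mulr1 addr0.
by rewrite mxE jN mulr0.
Qed.

Lemma dot_nondegenerate u : (forall v, dot u v = 0) -> u = 0.
Proof. by move=> u0; apply/rowP => i; rewrite -dot_delta u0 mxE. Qed.

Lemma dot_cross_cross u v w x :
  dot (cross u v) (cross w x) = dot u w * dot v x - dot u x * dot v w.
Proof.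
have [c0 c1 c2] := crossE u v; have [d0 d1 d2] := crossE w x.
by rewrite !dotE c0 c1 c2 d0 d1 d2; ring.
Qed.

Lemma dot_cross_l u v : dot (cross u v) u = 0.
Proof. by have [c0 c1 c2] := crossE u v; rewrite dotE c0 c1 c2; ring. Qed.

Lemma dot_cross_r u v : dot (cross u v) v = 0.
Proof. by have [c0 c1 c2] := crossE u v; rewrite dotE c0 c1 c2; ring. Qed.

Lemma dot_cross_rot u v w : dot (cross u v) w = dot (cross v w) u.
Proof.
have [c0 c1 c2] := crossE u v; have [d0 d1 d2] := crossE v w.
by rewrite !dotE c0 c1 c2 d0 d1 d2; ring.
Qed.

Lemma crossN u v : cross u v = - cross v u.
Proof.
have [c0 c1 c2] := crossE u v; have [d0 d1 d2] := crossE v u.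
by apply: row3P; rewrite !mxE ?c0 ?c1 ?c2; ring.
Qed.

Lemma cramer_row3 u v w x :
  dot (cross u v) w *: x = dot (cross v w) x *: u
    + dot (cross w u) x *: v + dot (cross u v) x *: w.
Proof.
have [c0 c1 c2] := crossE u v; have [d0 d1 d2] := crossE v w.
have [e0 e1 e2] := crossE w u.
by apply: row3P; rewrite !mxE !dotE c0 c1 c2 d0 d1 d2 e0 e1 e2; ring.
Qed.

Lemma cross_eq0 u : (forall v, cross u v = 0) -> u = 0.
Proof.
move=> u0.
have [_ a1 a2] := crossE u (delta_mx 0 0).
have [_ _ b2] := crossE u (delta_mx 0 1).
apply: row3P.
- by move: b2; rewrite u0 !mxE /= mulr0 subr0 mulr1 => <-.
- move: a2; rewrite u0 !mxE /= mulr0 sub0r mulr1 => /eqP.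
  by rewrite eq_sym oppr_eq0 => /eqP.
- by move: a1; rewrite u0 !mxE /= mulr0 subr0 mulr1 => <-.
Qed.

Lemma sub_adds_row u v x :
  (x <= u + v)%MS -> exists k l, x = k *: u + l *: v.
Proof.
case/sub_addsmxP => -[M N] /= ->; exists (M 0 0), (N 0 0).
by rewrite {1}[M]mx11_scalar {1}[N]mx11_scalar !mul_scalar_mx.
Qed.

(** Otherwise u, v, w span the space, so a vector orthogonal to all three is zero. This kills the
    three mutual cross products, then the cross product of each of u, v, w with any vector, and
    hence u, v, w themselves. *)
Lemma dot_cross_eq0_aligned u v w : dot (cross u v) w = 0 -> aligned u v w.
Proof.
move=> uvw0; rewrite /aligned leqNgt; apply/negP => rk3.
have span x : exists k l m, x = k *: u + l *: v + m *: w.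
  have : (x <= u + v + w)%MS.
    by rewrite submx_full // /row_full eqn_leq rank_leq_col.
  case/sub_addsmxP => -[M N] /= ->.
  have [|k [l ->]] := @sub_adds_row u v (M *m (u + v)%MS); first exact: submxMl.
  by exists k, l, (N 0 0); rewrite {1}[N]mx11_scalar mul_scalar_mx.
have dot0 y : dot y u = 0 -> dot y v = 0 -> dot y w = 0 -> y = 0.
  move=> yu yv yw; apply: dot_nondegenerate => x; have [k [l [m ->]]] := span x.
  by rewrite !dotDr !dotZr yu yv yw !mulr0 !addr0.
have uv0 : cross u v = 0 by apply: dot0; rewrite ?dot_cross_l ?dot_cross_r.
have vw0 : cross v w = 0.
  by apply: dot0; rewrite ?dot_cross_l ?dot_cross_r // -dot_cross_rot.
have wu0 : cross w u = 0.
  by apply: dot0; rewrite ?dot_cross_l ?dot_cross_r // dot_cross_rot.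
have zero x : (forall y, dot (cross x y) u = 0) ->
    (forall y, dot (cross x y) v = 0) ->
    (forall y, dot (cross x y) w = 0) -> x = 0.
  by move=> xu xv xw; apply: cross_eq0 => y; apply: dot0.
have anti x y : cross x y = 0 -> cross y x = 0.
  by rewrite (crossN y x) => ->; rewrite oppr0.
have z x y (t : 'rV[K]_3) : cross x y = 0 -> dot (cross y t) x = 0.
  by rewrite -dot_cross_rot => ->; rewrite dotE !mxE; ring.
have u0 : u = 0.
  apply: (zero u) => y; first exact: dot_cross_l.
  - by apply: z; apply: anti.
  - exact: z.
have v0 : v = 0.
  apply: (zero v) => y; [exact: z | exact: dot_cross_l |].
  by apply: z; apply: anti.
have w0 : w = 0.
  apply: (zero w) => y; [| exact: z | exact: dot_cross_l].
  by apply: z; apply: anti.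
by move: rk3; rewrite u0 v0 w0 !addsmx0 mxrank0.
Qed.

End CrossProduct.

(** * Coordinates in a basis and intersections of lines *)

Section Meet.

Variable K : fieldType.
Implicit Types (u v w x a b c n P : 'rV[K]_3) (al be ga k : K).

(* The dual basis of (u, v, w) consists of dual u v w, dual v w u and
   dual w u v. *)
Definition dual u v w : 'rV[K]_3 := (dot (cross u v) w)^-1 *: cross v w.

Lemma dual_self u v w : dot (cross u v) w != 0 -> dot (dual u v w) u = 1.
Proof. by move=> uvw; rewrite dotZl -(dot_cross_rot u) mulVf. Qed.

Lemma dual_l u v w : dot (dual u v w) v = 0.
Proof. by rewrite dotZl dot_cross_l mulr0. Qed.

Lemma dual_r u v w : dot (dual u v w) w = 0.
Proof. by rewrite dotZl dot_cross_r mulr0. Qed.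

Lemma dual_decomp u v w x : dot (cross u v) w != 0 ->
  x = dot (dual u v w) x *: u + dot (dual v w u) x *: v
    + dot (dual w u v) x *: w.
Proof.
move=> uvw; apply: (scalerI uvw); rewrite cramer_row3 !scalerDr !scalerA !dotZl.
by rewrite (dot_cross_rot w u v) -(dot_cross_rot u v w) !mulrA mulfV // !mul1r.
Qed.

Lemma row_decomp u v w x : dot (cross u v) w != 0 ->
  exists al be ga, x = al *: u + be *: v + ga *: w.
Proof. by move/dual_decomp => /(_ x) ->; do 3!eexists. Qed.

Lemma dot_eq0 u v w x : dot (cross u v) w != 0 ->
  dot x u = 0 -> dot x v = 0 -> dot x w = 0 -> x = 0.
Proof.
move=> uvw xu xv xw; apply: dot_nondegenerate => y.
by rewrite (dual_decomp y uvw) !dotDr !dotZr xu xv xw !mulr0 !addr0.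
Qed.

Lemma det_swap u v w : dot (cross u v) w != 0 -> dot (cross u w) v != 0.
Proof. by rewrite (crossN u w) dotN oppr_eq0 (dot_cross_rot w u v). Qed.

(** The dual vectors of a and b annihilate c, so reading the a and b coordinates of P in both
    descriptions shows that they are k times those of n. *)
Lemma meet_point a b c n P al be ga : dot (cross a b) c != 0 -> P != 0 ->
    n = al *: a + be *: b + ga *: c ->
    (P <= a + b)%MS -> (P <= c + n)%MS ->
  exists2 k, k != 0 & P = k *: (al *: a + be *: b).
Proof.
move=> abc P0 nE /sub_adds_row [x [y PE]] /sub_adds_row [z [k PE']].
have bca : dot (cross b c) a != 0 by rewrite -dot_cross_rot.
have xE : x = k * al.
  transitivity (dot (dual a b c) P).
    by rewrite PE !dotDr !dotZr dual_self ?dual_l //; ring.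
  by rewrite PE' nE !(dotDr, dotZr) dual_self ?dual_l ?dual_r //; ring.
have yE : y = k * be.
  transitivity (dot (dual b c a) P).
    by rewrite PE !dotDr !dotZr dual_self ?dual_r //; ring.
  by rewrite PE' nE !(dotDr, dotZr) dual_self ?dual_l ?dual_r //; ring.
have PE1 : P = k *: (al *: a + be *: b) by rewrite scalerDr !scalerA -xE -yE.
by exists k => //; apply: contraNneq P0 => k0; rewrite PE1 k0 scale0r.
Qed.

(** If [ga] were zero, n would lie in the span of a and b, and the relations would make v = <b,c> a
    - <a,c> b orthogonal to a, b and c. Then v = 0, so <b,c> = <a,c> = 0 by independence, and n
    itself is orthogonal to the basis, contradicting n <> 0. *)
Lemma coord_neq0 a b c n al be ga : dot (cross a b) c != 0 ->
    n = al *: a + be *: b + ga *: c ->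
    dot n a = dot a b * dot a c -> dot n b = dot a b * dot b c ->
    dot n c = dot a c * dot b c -> n != 0 -> al != 0 -> be != 0 ->
  ga != 0.
Proof.
move=> abc nE na nb nc n0 al0 be0; apply: contraNneq n0 => ga0.
move: na nb nc; rewrite nE ga0 scale0r addr0 !(dotDl, dotZl) (dotC b a).
move=> na nb nc.
pose v := dot b c *: a - dot a c *: b.
have vE x : dot v x = dot b c * dot a x - dot a c * dot b x.
  by rewrite /v dotDl dotZl -scaleNr dotZl mulNr.
have v0 : v = 0.
  apply: (dot_eq0 abc); last by rewrite vE; ring.
    apply: (mulfI al0); rewrite vE (dotC b a) mulr0.
    transitivity (dot b c * (al * dot a a + be * dot a b - dot a b * dot a c)
      - dot a b * (al * dot a c + be * dot b c - dot a c * dot b c));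
      first by ring.
    by rewrite na nc; ring.
  apply: (mulfI be0); rewrite vE mulr0.
  transitivity (dot a b * (al * dot a c + be * dot b c - dot a c * dot b c)
    - dot a c * (al * dot a b + be * dot b b - dot a b * dot b c));
    first by ring.
  by rewrite nb nc; ring.
have bca : dot (cross b c) a != 0 by rewrite -dot_cross_rot.
have bc0 : dot b c = 0.
  transitivity (dot v (dual a b c)); last by rewrite v0 dot0.
  by rewrite vE !(dotC _ (dual a b c)) dual_self // dual_l; ring.
have ac0 : dot a c = 0.
  transitivity (- dot v (dual b c a)); last by rewrite v0 dot0 oppr0.
  by rewrite vE !(dotC _ (dual b c a)) dual_self // dual_r; ring.
by apply/eqP; apply: (dot_eq0 abc);
  rewrite !(dotDl, dotZl) ?(dotC b a) ?na ?nb ?nc ?bc0 ?ac0; ring.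
Qed.

End Meet.

(** * The linear relation imposed by an eigenpoint on a side of the triangle *)

Section Relation.

Variable K : numFieldType.
Implicit Types (f : {mpoly K[3]}) (a b c n u v w : 'rV[K]_3).

(** For cubic f, the scalar m is twice the factor relating the gradient to u, since the polar form
    at (u, u, w) is twice the gradient paired with w. *)
Definition eigenvector f u m := forall w, polar f u u w = m * dot u w.

(** Write n = al a + be b + ga c. The first two hypotheses say that w = n - <a,b> c is orthogonal to
    a and b. Testing the condition at al a + be b against w therefore eliminates m and leaves T(a,
    b, w) = 0, which expands to the relation. *)
Lemma eigenvector_relation f a b c al be ga la lb m :
    dot (al *: a + be *: b + ga *: c) a = dot a b * dot a c ->
    dot (al *: a + be *: b + ga *: c) b = dot a b * dot b c ->
    al != 0 -> be != 0 ->
    eigenvector f a la -> eigenvector f b lb ->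
    eigenvector f (al *: a + be *: b) m ->
  dot a b * (al * la + be * lb) = (dot a b - ga) * polar f a b c.
Proof.
rewrite !(dotDl, dotZl) !(dotC c) (dotC b a) => na nb al0 be0 fa fb fab.
have expand w : al ^+ 2 * (la * dot a w) + be ^+ 2 * (lb * dot b w)
    + 2 * al * be * polar f a b w = m * (al * dot a w + be * dot b w).
  rewrite -fa -fb -!dotZl -dotDl -fab !(polarDl, polarZl, polarDm, polarZm).
  by rewrite (polarC12 f b a); ring.
have := expand a; have := expand b; have := expand c.
have -> : polar f a b b = lb * dot a b.
  by rewrite polarC12 polarC23 fb dotC.
have -> : polar f a b a = la * dot a b by rewrite polarC23 fa.
rewrite (dotC b a) => Ec Eb Ea.
have ab0 : 2 * al * be != 0 by rewrite !mulf_neq0 // pnatr_eq0.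
apply: (mulfI ab0).
(* The coefficients of [Ea], [Eb], [Ec] are the coordinates of w = n - <a,b> c; the multiples of
   [na] and [nb] remove the terms in <a,w> and <b,w>. *)
have := congr2 +%R (congr2 +%R (congr1 ( *%R al) Ea) (congr1 ( *%R be) Eb))
  (congr2 +%R (congr1 ( *%R (ga - dot a b)) Ec)
    (congr2 +%R (congr1 ( *%R (al * (m - al * la))) na)
                (congr1 ( *%R (be * (m - be * lb))) nb))).
by move/eq_of_subr_eq; apply; ring.
Qed.

End Relation.

(** * Eigenpoints as eigenvectors, and the explicit cubic *)

Section Eigenpoint.

Variable K : numFieldType.
Implicit Types (f g : {mpoly K[3]}) (a b c n u v w d : 'rV[K]_3).

Lemma row_collinear u v i : u 0 i != 0 ->
  (forall j, u 0 i * v 0 j = u 0 j * v 0 i) -> v = (v 0 i / u 0 i) *: u.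
Proof.
move=> ui uv; apply/rowP => j; rewrite mxE; apply: (mulfI ui).
by rewrite uv; field.
Qed.

Lemma eigenpoint_minor f u (h : 'I_2 -> 'I_3) :
  \det (colsub h (col_mx u (gradient f u)))
    = u 0 (h 0) * gradient f u 0 (h 1) - u 0 (h 1) * gradient f u 0 (h 0).
Proof.
have split0 : split (0 : 'I_(1 + 1)) = inl 0.
  by rewrite -(unsplitK (inl _)) /=; congr split; apply: val_inj.
have split1 : split (1 : 'I_(1 + 1)) = inr 0.
  by rewrite -(unsplitK (inr _)) /=; congr split; apply: val_inj.
rewrite (expand_det_row _ 0) !big_ord_recl big_ord0 /cofactor !det_mx11 !mxE.
rewrite (_ : lift 0 0 = 1); last exact: val_inj.
rewrite (_ : lift 1 0 = 0); last exact: val_inj.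
by rewrite split0 split1 !mxE /=; ring.
Qed.

(** The minors through one column i with u_i <> 0 already force the gradient to be a multiple of
    u. *)
Lemma eigenpointP f u : u != 0 ->
  eigenpoint f u <-> exists m, forall w, dot (gradient f u) w = m * dot u w.
Proof.
move=> u0; split=> [fu | [m fu] h]; last first.
  rewrite eigenpoint_minor -!(dot_delta (gradient f u)) !fu !dot_delta; ring.
have [i ui] : exists i, u 0 i != 0 by apply/rV0Pn.
exists (gradient f u 0 i / u 0 i) => w; rewrite -dotZl.
rewrite -row_collinear // => j; pose h (k : 'I_2) := if k == 0 then i else j.
by have /eqP := fu h; rewrite eigenpoint_minor /h /= subr_eq0 => /eqP.
Qed.

Lemma eigenpoint_eigenvector f u : f \is 3.-homog -> u != 0 ->
  eigenpoint f u <-> exists m, eigenvector f u m.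
Proof.
have two0 : (2 : K) != 0 by rewrite pnatr_eq0.
move=> hf u0; apply: iff_trans (eigenpointP f u0) _; split=> -[m fm].
  by exists (2 * m) => w; rewrite -dot_gradient // fm mulrA.
exists (m / 2) => w; apply: (mulfI two0); rewrite dot_gradient // fm.
by field.
Qed.

Lemma eigenvector_scale f u k : k != 0 ->
  (exists m, eigenvector f (k *: u) m) -> exists m, eigenvector f u m.
Proof.
move=> k0 [m fm]; exists (m / k) => w; apply: (mulfI k0).
apply: (mulfI k0); rewrite -polarZm -polarZl fm dotZl; field; exact: k0.
Qed.

Lemma eigenvector_sub f g u k :
  (exists m, eigenvector f u m) -> (exists m, eigenvector g u m) ->
  exists m, eigenvector (f - k *: g) u m.
Proof.
move=> [m fm] [m' gm]; exists (m - k * m') => w.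
by rewrite polar_sub fm gm; ring.
Qed.

Lemma dot_gradientD f g u w :
  dot (gradient (f + g) u) w = dot (gradient f u) w + dot (gradient g u) w.
Proof. by rewrite !dotE !mxE !mderivD !mevalD; ring. Qed.

Lemma dot_gradientZ k f u w :
  dot (gradient (k *: f) u) w = k * dot (gradient f u) w.
Proof. by rewrite !dotE !mxE !mderivZ !mevalZ; ring. Qed.

Lemma dot_gradientM f g u w : dot (gradient (f * g) u) w
  = dot (gradient f u) w * g.@[u 0] + f.@[u 0] * dot (gradient g u) w.
Proof. by rewrite !dotE !mxE !mderivM !mevalD !mevalM; ring. Qed.

Lemma meval_sum (F : 'I_3 -> {mpoly K[3]}) u :
  (\sum_i F i).@[u 0] = \sum_i (F i).@[u 0].
Proof. exact: raddf_sum. Qed.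

Lemma mderiv_sum (F : 'I_3 -> {mpoly K[3]}) i :
  (\sum_j F j)^`M(i) = \sum_j (F j)^`M(i).
Proof. exact: raddf_sum. Qed.

Definition linear_form d : {mpoly K[3]} := \sum_i d 0 i *: 'X_i.

Lemma linear_form_homog d : linear_form d \is 1.-homog.
Proof.
by apply: rpred_sum => i _; apply: dhomogZ; rewrite dhomogX /= mdeg1.
Qed.

Lemma meval_linear_form d u : (linear_form d).@[u 0] = dot d u.
Proof.
rewrite /linear_form /dot meval_sum; apply: eq_bigr => i _.
by rewrite mevalZ mevalXU.
Qed.

Lemma dot_gradient_linear_form d u w :
  dot (gradient (linear_form d) u) w = dot d w.
Proof.
apply: eq_bigr => i _; rewrite mxE -[in RHS](dot_delta d); congr (_ * _).
rewrite -(meval_linear_form d) /linear_form mderiv_sum !meval_sum.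
apply: eq_bigr => j _; rewrite mderivZ !mevalZ mderivX mevalZ mevalX mevalXU.
rewrite !mxE eqxx andTb mnm1E.
congr (_ * _); have [->|ji] := eqVneq j i; last by rewrite mul0r.
by rewrite mul1r big1 // => k _; rewrite mnmBE subnn expr0.
Qed.

(* Chosen so that its polar form T satisfies T(u, u, .) = 6 l <u, .> and
   vanishes at (v, v, .), (w, w, .) and (u, v, w). *)
Definition vertex_cubic u v w (l : K) : {mpoly K[3]} :=
  let A := linear_form (dual u v w) in
  l *: (3 *: (A * A * linear_form u) + (- 2 * dot u u) *: (A * A * A)).

(** The three vertex cubics prescribe T at (a, a, .), (b, b, .) and (c, c, .); the product of the
    coordinate forms contributes only T(a, b, c) = 12 p q r. All values are 6 times the [la], [lb],
    [lc], [t] of the opening outline. *)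
Definition c8_cubic a b c : {mpoly K[3]} :=
  let p := dot b c in let q := dot a c in let r := dot a b in
  vertex_cubic a b c (p * dot a a + q * r)
  + vertex_cubic b c a (q * dot b b + p * r)
  + vertex_cubic c a b (r * dot c c + p * q)
  + (12 * p * q * r) *: (linear_form (dual a b c) * linear_form (dual b c a)
     * linear_form (dual c a b)).

Lemma c8_cubic_homog a b c : c8_cubic a b c \is 3.-homog.
Proof.
have lin3 d1 d2 d3 :
    linear_form d1 * linear_form d2 * linear_form d3 \is 3.-homog.
  by apply: (@dhomogM _ _ _ 2 _ 1); rewrite ?linear_form_homog //;
    apply: (@dhomogM _ _ _ 1 _ 1); rewrite linear_form_homog.
by do !apply: dhomogD; do ?[apply: dhomogZ]; try apply: dhomogD;
  do ?[apply: dhomogZ]; apply: lin3.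
Qed.

Lemma dot_gradient_vertex_cubic u v w l x y :
  dot (gradient (vertex_cubic u v w l) x) y =
  l * (6 * dot (dual u v w) x * dot (dual u v w) y * dot u x
       + 3 * dot (dual u v w) x ^+ 2 * dot u y
       - 6 * dot u u * dot (dual u v w) x ^+ 2 * dot (dual u v w) y).
Proof.
rewrite /vertex_cubic !(dot_gradientD, dot_gradientZ, dot_gradientM,
  dot_gradient_linear_form, meval_linear_form, mevalM) /=; ring.
Qed.

(** In the basis a, b, c the dual vectors are coordinate functions, so the gradient becomes a
    polynomial in coordinates and the six dot products. Each eigenpoint condition is then a scalar
    identity. *)
Lemma dot_gradient_c8_cubic a b c x y z X Y Z : dot (cross a b) c != 0 ->
  let p := dot b c in let q := dot a c in let r := dot a b in
  let saa := dot a a in let sbb := dot b b in let scc := dot c c in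
  dot (gradient (c8_cubic a b c) (x *: a + y *: b + z *: c))
      (X *: a + Y *: b + Z *: c) =
  (p * saa + q * r) * (6 * x * X * (x * saa + y * r + z * q)
     + 3 * x ^+ 2 * (X * saa + Y * r + Z * q) - 6 * saa * x ^+ 2 * X)
  + (q * sbb + p * r) * (6 * y * Y * (x * r + y * sbb + z * p)
     + 3 * y ^+ 2 * (X * r + Y * sbb + Z * p) - 6 * sbb * y ^+ 2 * Y)
  + (r * scc + p * q) * (6 * z * Z * (x * q + y * p + z * scc)
     + 3 * z ^+ 2 * (X * q + Y * p + Z * scc) - 6 * scc * z ^+ 2 * Z)
  + 12 * p * q * r * (X * y * z + x * Y * z + x * y * Z).
Proof.
move=> abc /=.
have bca : dot (cross b c) a != 0 by rewrite -dot_cross_rot.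
have cab : dot (cross c a) b != 0 by rewrite dot_cross_rot.
rewrite /c8_cubic; lazy zeta; rewrite 3!dot_gradientD.
(* Rewriting with V would try to unify unfolded polynomials. *)
have V := dot_gradient_vertex_cubic.
apply: etrans (congr2 +%R (congr2 +%R (congr2 +%R
  (V _ _ _ _ _ _) (V _ _ _ _ _ _)) (V _ _ _ _ _ _)) (dot_gradientZ _ _ _ _)) _.
rewrite !(dot_gradientM, dot_gradient_linear_form, meval_linear_form, mevalM).
rewrite !(dotDr, dotZr) !dual_self // !dual_l !dual_r.
rewrite (dotC b a) (dotC c a) (dotC c b); ring.
Qed.

End Eigenpoint.

(** * The formula for the seventh point, and the seven eigenpoints *)

Section Configuration.

Variable K : numFieldType.
Implicit Types (f g : {mpoly K[3]}) (a b c n u v w P : 'rV[K]_3).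

(** Each cross product is orthogonal to its two factors, so only one of the three terms survives
    each pairing. *)
Lemma dot_P7_formula a b c :
  let n := P7_formula a b c in let D := dot (cross a b) c in
  [/\ dot n a = D * (dot a b * dot a c), dot n b = D * (dot a b * dot b c)
    & dot n c = D * (dot a c * dot b c)].
Proof.
rewrite /P7_formula -!scaleNr; split;
  rewrite !(dotDl, dotZl) ?dot_cross_l ?dot_cross_r.
- by rewrite -(dot_cross_rot a); ring.
- by rewrite (dot_cross_rot a c) (crossN c b) dotN -dot_cross_rot; ring.
- by ring.
Qed.

Lemma two_dots_neq0 a b c : P7_formula a b c != 0 ->
  [|| (dot a b != 0) && (dot a c != 0), (dot a b != 0) && (dot b c != 0)
    | (dot a c != 0) && (dot b c != 0)].
Proof.
apply: contraNT; rewrite /P7_formula.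
case: eqP => [->|_]; case: eqP => [->|_]; case: eqP => [->|_] //= _;
  by rewrite ?(mulr0, mul0r) !scale0r ?(subr0, addr0).
Qed.

Section Existence.

Variables (a b c : 'rV[K]_3) (al be ga : K).
Let n := al *: a + be *: b + ga *: c.
Hypothesis abc : dot (cross a b) c != 0.
Hypothesis na : dot n a = dot a b * dot a c.
Hypothesis nb : dot n b = dot a b * dot b c.
Hypothesis nc : dot n c = dot a c * dot b c.
Hypotheses (al0 : al != 0) (be0 : be != 0) (ga0 : ga != 0).
Let p := dot b c.
Let q := dot a c.
Let r := dot a b.

(** Solves <n,a> = q r for the squared norm. With its two analogues it eliminates all squared norms,
    leaving identities in p, q, r and the coordinates of n for [field]. *)
Let saa : dot a a = (r * q - be * r - ga * q) / al.
Proof.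
by apply: (mulfI al0); rewrite /r /q -na /n !(dotDl, dotZl) (dotC b a);
  rewrite (dotC c a); field.
Qed.

Let sbb : dot b b = (r * p - al * r - ga * p) / be.
Proof.
by apply: (mulfI be0); rewrite /r /p -nb /n !(dotDl, dotZl) (dotC c b); field.
Qed.

Let scc : dot c c = (q * p - al * q - be * p) / ga.
Proof. by apply: (mulfI ga0); rewrite /q /p -nc /n !(dotDl, dotZl); field. Qed.

(** These are al <n,a>, be <n,b> and ga <n,c>, with sum <n,n>. In the eigenvalues below, the sign is
    negative exactly for the vertex missing from a point on a side. *)
Let E1 := r * q * al.
Let E2 := r * p * be.
Let E3 := p * q * ga.

Lemma c8_cubic_eigenpoints k :
  [/\ [/\ k *: a != 0 -> eigenpoint (c8_cubic a b c) (k *: a),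
      k *: b != 0 -> eigenpoint (c8_cubic a b c) (k *: b)
    & k *: c != 0 -> eigenpoint (c8_cubic a b c) (k *: c)],
   [/\ k *: (al *: a + be *: b) != 0 ->
        eigenpoint (c8_cubic a b c) (k *: (al *: a + be *: b)),
      k *: (al *: a + ga *: c) != 0 ->
        eigenpoint (c8_cubic a b c) (k *: (al *: a + ga *: c))
    & k *: (be *: b + ga *: c) != 0 ->
        eigenpoint (c8_cubic a b c) (k *: (be *: b + ga *: c))]
   & k *: n != 0 -> eigenpoint (c8_cubic a b c) (k *: n)].
Proof.
(* It suffices to treat one representative u: the gradient is quadratic, so a factor m at u becomes
   k m at k u. *)
have point x y z m u : u = x *: a + y *: b + z *: c ->
    (forall X Y Z, dot (gradient (c8_cubic a b c) (x *: a + y *: b + z *: c))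
        (X *: a + Y *: b + Z *: c)
      = m * (X * (x * dot a a + y * r + z * q)
        + Y * (x * r + y * dot b b + z * p)
        + Z * (x * q + y * p + z * dot c c))) ->
    k *: u != 0 -> eigenpoint (c8_cubic a b c) (k *: u).
  move=> -> fm u0; apply/eigenpointP => //; exists (k * m) => w.
  have two0 : (2 : K) != 0 by rewrite pnatr_eq0.
  apply: (mulfI two0); rewrite dot_gradient ?c8_cubic_homog // polarZl polarZm.
  rewrite -dot_gradient ?c8_cubic_homog //.
  have [X [Y [Z ->]]] := row_decomp w abc.
  rewrite fm !(dotDl, dotZl, dotDr, dotZr) (dotC b a) (dotC c a) (dotC c b).
  by rewrite /p /q /r; ring.
split; first split.
(* The 3 is half of the 6 in [vertex_cubic], the gradient pairing being half of the polar form. *)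
- apply: (point 1 0 0 (3 * (p * dot a a + q * r))) => [|X Y Z].
    by rewrite !scale0r scale1r !addr0.
  by rewrite dot_gradient_c8_cubic // -/p -/q -/r; ring.
- apply: (point 0 1 0 (3 * (q * dot b b + p * r))) => [|X Y Z].
    by rewrite !scale0r scale1r addr0 add0r.
  by rewrite dot_gradient_c8_cubic // -/p -/q -/r; ring.
- apply: (point 0 0 1 (3 * (r * dot c c + p * q))) => [|X Y Z].
    by rewrite !scale0r scale1r !add0r.
  by rewrite dot_gradient_c8_cubic // -/p -/q -/r; ring.
- split.
  + apply: (point al be 0 (3 * (p * q * r + E1 + E2 - E3))) => [|X Y Z].
      by rewrite scale0r addr0.
    rewrite dot_gradient_c8_cubic // -/p -/q -/r saa sbb scc.
    rewrite /E1 /E2 /E3; field.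
    by rewrite al0 be0 ga0.
  + apply: (point al 0 ga (3 * (p * q * r + E1 - E2 + E3))) => [|X Y Z].
      by rewrite scale0r addr0.
    rewrite dot_gradient_c8_cubic // -/p -/q -/r saa sbb scc.
    rewrite /E1 /E2 /E3; field.
    by rewrite al0 be0 ga0.
  + apply: (point 0 be ga (3 * (p * q * r - E1 + E2 + E3))) => [|X Y Z].
      by rewrite scale0r add0r.
    rewrite dot_gradient_c8_cubic // -/p -/q -/r saa sbb scc.
    rewrite /E1 /E2 /E3; field.
    by rewrite al0 be0 ga0.
- apply: (point al be ga (3 * (p * q * r + E1 + E2 + E3))) => // X Y Z.
  rewrite dot_gradient_c8_cubic // -/p -/q -/r saa sbb scc.
  rewrite /E1 /E2 /E3; field.
  by rewrite al0 be0 ga0.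
Qed.

End Existence.
End Configuration.

(** * Nonvanishing of the cubic and uniqueness up to scaling *)

Section Uniqueness.

Variable K : numFieldType.
Implicit Types (f g h : {mpoly K[3]}) (a b c n u v w P : 'rV[K]_3).

(** A zero cubic would have T(a, b, c) = 0, hence p q r = 0. If p = 0, the gradient at a paired with
    b is 3 q r^2, nonzero because q and r are; the other cases are similar. *)
Lemma c8_cubic_neq0 a b c : dot (cross a b) c != 0 ->
  P7_formula a b c != 0 -> c8_cubic a b c != 0.
Proof.
move=> abc /two_dots_neq0 pqr; apply/eqP => f0.
have grad0 x y z X Y Z :
    dot (gradient (c8_cubic a b c) (x *: a + y *: b + z *: c))
        (X *: a + Y *: b + Z *: c) = 0.
  by rewrite f0 dotE !mxE !mderiv0 !meval0 !mul0r !addr0.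
have := grad0 0 1 1 1 0 0; have := grad0 0 0 1 1 0 0; have := grad0 0 1 0 1 0 0.
have := grad0 1 0 0 0 1 0; have := grad0 0 1 0 0 0 1.
rewrite !dot_gradient_c8_cubic //.
move: pqr; set p := dot b c; set q := dot a c; set r := dot a b => pqr.
set saa := dot a a; set sbb := dot b b; set scc := dot c c.
move=> gbc gab gba gca gbca.
have n12 : (12 : K) != 0 by rewrite pnatr_eq0.
have n3 : (3 : K) != 0 by rewrite pnatr_eq0.
(* Polarisation: the gradient at b + c minus those at b and c, paired with a, is 12 p q r. *)
have pqr0 : p * q * r = 0.
  apply: (mulfI n12); move: (congr2 +%R gbca (congr1 -%R (congr2 +%R gba gca))).
  by move/eq_of_subr_eq; apply; ring.
have /orP[/orP[|]|] : (p == 0) || (q == 0) || (r == 0).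
- by move/eqP: pqr0; rewrite !mulf_eq0.
- move=> /eqP p0; move: gab pqr; rewrite p0 !eqxx !andbF !orbF.
  move=> gab /andP[r0 q0].
  have : 3 * q * r ^+ 2 = 0 by move: gab => /eq_of_subr_eq; apply; ring.
  by apply/eqP; rewrite !mulf_neq0 // expf_neq0.
- move=> /eqP q0; move: gbc pqr; rewrite q0 !eqxx !andbF !orbF.
  move=> gbc /andP[r0 p0].
  have : 3 * r * p ^+ 2 = 0 by move: gbc => /eq_of_subr_eq; apply; ring.
  by apply/eqP; rewrite !mulf_neq0 // expf_neq0.
- move=> /eqP r0; move: gca pqr; rewrite r0 !eqxx /= => gca /andP[q0 p0].
  have : 3 * p * q ^+ 2 = 0 by move: gca => /eq_of_subr_eq; apply; ring.
  by apply/eqP; rewrite !mulf_neq0 // expf_neq0.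
Qed.

(** By symmetry every triple of basis vectors either repeats a vector or is a permutation of (a, b,
    c), so these values determine the trilinear form. *)
Lemma polar_basis_eq0 h a b c : dot (cross a b) c != 0 -> h \is 3.-homog ->
    eigenvector h a 0 -> eigenvector h b 0 -> eigenvector h c 0 ->
    polar h a b c = 0 -> h = 0.
Proof.
move=> abc hh ha hb hc habc; apply: (polar_inj0 hh) => u v w.
have [ha1 hb1 hc1] : [/\ forall w, polar h a a w = 0,
    forall w, polar h b b w = 0 & forall w, polar h c c w = 0].
  by split=> x; rewrite ?ha ?hb ?hc mul0r.
have [[x [y [z ->]]] [x' [y' [z' ->]]]] := (row_decomp u abc, row_decomp v abc).
have [X [Y [Z ->]]] := row_decomp w abc.
rewrite !(polarDl, polarZl, polarDm, polarZm, polarDr, polarZr).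
rewrite !(ha1, hb1, hc1).
have [ba ca cb] : [/\ forall w, polar h b a w = polar h a b w,
   forall w, polar h c a w = polar h a c w
   & forall w, polar h c b w = polar h b c w].
  by split=> t; rewrite polarC12.
rewrite !(ba, ca, cb).
rewrite (polarC23 h a b a) (polarC23 h a c a) (polarC23 h b c b)
  (polarC23 h a c b) (polarC12 h a b b) (polarC12 h a c c) (polarC12 h b c c)
  (polarC23 h b a b) (polarC23 h c a c) (polarC23 h c b c) !(ha1, hb1, hc1).
rewrite (polarC23 h b c a) ba !habc.
ring.
Qed.

(** Bounds the dimension of the space of eigencubics by one: a single linear functional h -> T(u, v,
    w) is injective on it. The choice of (u, v, w) depends on which of p, q, r vanishes. *)
Lemma c8_eigencubic_determined a b c al be ga :
    let n := al *: a + be *: b + ga *: c in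
    dot (cross a b) c != 0 -> P7_formula a b c != 0 ->
    dot n a = dot a b * dot a c -> dot n b = dot a b * dot b c ->
    dot n c = dot a c * dot b c -> al != 0 -> be != 0 -> ga != 0 ->
  exists u v w, forall h, h \is 3.-homog ->
    (forall P, P \in [:: a; b; c; al *: a + be *: b; al *: a + ga *: c;
       be *: b + ga *: c] -> exists m, eigenvector h P m) ->
    polar h u v w = 0 -> h = 0.
Proof.
move=> n abc /two_dots_neq0 pqr na nb nc al0 be0 ga0.
have rel h : (forall P, P \in [:: a; b; c; al *: a + be *: b; al *: a + ga *: c;
       be *: b + ga *: c] -> exists m, eigenvector h P m) -> exists la lb lc,
   [/\ eigenvector h a la, eigenvector h b lb, eigenvector h c lc &
   [/\ dot a b * (al * la + be * lb) = (dot a b - ga) * polar h a b c,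
     dot a c * (al * la + ga * lc) = (dot a c - be) * polar h a b c
   & dot b c * (be * lb + ga * lc) = (dot b c - al) * polar h a b c]].
  move=> hP; have [la ha] : exists m, eigenvector h a m.
    by apply: hP; rewrite !inE eqxx.
  have [lb hb] : exists m, eigenvector h b m.
    by apply: hP; rewrite !inE eqxx ?orbT.
  have [lc hc] : exists m, eigenvector h c m.
    by apply: hP; rewrite !inE eqxx ?orbT.
  have [m3 h3] : exists m, eigenvector h (al *: a + be *: b) m.
    by apply: hP; rewrite !inE eqxx ?orbT.
  have [m5 h5] : exists m, eigenvector h (al *: a + ga *: c) m.
    by apply: hP; rewrite !inE eqxx ?orbT.
  have [m6 h6] : exists m, eigenvector h (be *: b + ga *: c) m.
    by apply: hP; rewrite !inE eqxx ?orbT.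
  exists la, lb, lc; split=> //; split.
  - exact: eigenvector_relation na nb al0 be0 ha hb h3.
  - rewrite polarC23; apply: eigenvector_relation _ _ al0 ga0 ha hc h5.
      by rewrite addrAC -/n na mulrC.
    by rewrite addrAC -/n nc (dotC c b).
  - rewrite polarC12 polarC23; apply: eigenvector_relation _ _ be0 ga0 hb hc h6.
      by rewrite addrC addrA -/n nb (dotC b a) mulrC.
    by rewrite addrC addrA -/n nc (dotC c a) mulrC.
pose p := dot b c; pose q := dot a c; pose r := dot a b.
rewrite -/p -/q -/r in pqr rel.
have two0 : (2 : K) != 0 by rewrite pnatr_eq0.
have conclude h la lb lc : h \is 3.-homog -> polar h a b c = 0 ->
    eigenvector h a la -> eigenvector h b lb -> eigenvector h c lc ->
    al * la = 0 -> be * lb = 0 -> ga * lc = 0 -> h = 0.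
  move=> hh habc ha hb hc /eqP + /eqP + /eqP; rewrite !mulf_eq0.
  rewrite (negbTE al0) (negbTE be0) (negbTE ga0) /=.
  move=> /eqP la0 /eqP lb0 /eqP lc0.
  rewrite la0 in ha; rewrite lb0 in hb; rewrite lc0 in hc.
  exact: (polar_basis_eq0 abc).
(* When one of r, q, p vanishes, a relation forces t = 0, so t no longer
   separates the eigencubics; one of lc, lb, la then does. *)
have [r0|r0] := eqVneq r 0.
  move: pqr; rewrite r0 eqxx /= => /andP[q0 p0].
  exists c, c, a => h hh /rel [la [lb [lc [ha hb hc [R1 R2 R3]]]]].
  rewrite hc (dotC c a) -/q => /eqP; rewrite mulf_eq0 (negbTE q0) orbF.
  move/eqP=> lc0.
  have habc : polar h a b c = 0.
    move/eqP: R1; rewrite r0 mul0r sub0r eq_sym mulf_eq0 oppr_eq0 (negbTE ga0).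
    by move/eqP.
  move/eqP: R2; rewrite habc mulr0 lc0 mulr0 addr0 mulf_eq0 (negbTE q0).
  move/eqP=> la0.
  move/eqP: R3; rewrite habc mulr0 lc0 mulr0 addr0 mulf_eq0 (negbTE p0).
  move/eqP=> lb0.
  by apply: (conclude h la lb lc) => //; rewrite lc0 mulr0.
have [q0|q0] := eqVneq q 0.
  move: pqr; rewrite q0 eqxx /= andbF orbF => /andP[_ p0].
  exists b, b, c => h hh /rel [la [lb [lc [ha hb hc [R1 R2 R3]]]]].
  rewrite hb -/p => /eqP; rewrite mulf_eq0 (negbTE p0) orbF => /eqP lb0.
  have habc : polar h a b c = 0.
    move/eqP: R2; rewrite q0 mul0r sub0r eq_sym mulf_eq0 oppr_eq0 (negbTE be0).
    by move/eqP.
  move/eqP: R1; rewrite habc mulr0 lb0 mulr0 addr0 mulf_eq0 (negbTE r0).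
  move/eqP=> la0.
  move/eqP: R3; rewrite habc mulr0 lb0 mulr0 add0r mulf_eq0 (negbTE p0).
  move/eqP=> lc0.
  by apply: (conclude h la lb lc) => //; rewrite lb0 mulr0.
have [p0|p0] := eqVneq p 0.
  exists a, a, b => h hh /rel [la [lb [lc [ha hb hc [R1 R2 R3]]]]].
  rewrite ha -/r => /eqP; rewrite mulf_eq0 (negbTE r0) orbF => /eqP la0.
  have habc : polar h a b c = 0.
    move/eqP: R3; rewrite p0 mul0r sub0r eq_sym mulf_eq0 oppr_eq0 (negbTE al0).
    by move/eqP.
  move/eqP: R1; rewrite habc mulr0 la0 mulr0 add0r mulf_eq0 (negbTE r0).
  move/eqP=> lb0.
  move/eqP: R2; rewrite habc mulr0 la0 mulr0 add0r mulf_eq0 (negbTE q0).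
  move/eqP=> lc0.
  by apply: (conclude h la lb lc) => //; rewrite la0 mulr0.
exists a, b, c => h hh /rel [la [lb [lc [ha hb hc [R1 R2 R3]]]]] habc.
move: R1 R2 R3; rewrite habc !mulr0.
move=> /(canRL (mulKf r0)) R1 /(canRL (mulKf q0)) R2 /(canRL (mulKf p0)) R3.
rewrite !mulr0 in R1 R2 R3.
(* The pairwise sums of al la, be lb, ga lc all vanish; adding two of them and subtracting the third
   isolates twice one term. *)
apply: (conclude h la lb lc) => //; apply: (mulfI two0).
- move: (congr2 +%R R1 (congr2 +%R R2 (congr1 -%R R3))).
  by move/eq_of_subr_eq; apply; ring.
- move: (congr2 +%R R1 (congr2 +%R R3 (congr1 -%R R2))).
  by move/eq_of_subr_eq; apply; ring.
- move: (congr2 +%R R2 (congr2 +%R R3 (congr1 -%R R1))).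
  by move/eq_of_subr_eq; apply; ring.
Qed.

End Uniqueness.

(** * Assembly of the configuration, the cubic and the orthogonality relations *)

Section Main.

Variable K : numFieldType.

Lemma aligned_sub (P Q R S T : 'rV[K]_3) :
  (P + Q + R <= S + T)%MS -> aligned P Q R.
Proof.
move=> PQR; rewrite /aligned (leq_trans (mxrankS PQR)) //.
rewrite (leq_trans (mxrank_adds_leqif _ _)) //.
exact: (leq_add (rank_leq_row _) (rank_leq_row _)).
Qed.

Lemma c8_eigencubic (P1 P2 P3 P4 P5 P6 P7 : 'rV[K]_3)
  (points : all (fun P => P != 0) [:: P1; P2; P3; P4; P5; P6; P7])
  (not_aligned : ~ aligned P1 P2 P4)
  (P7_neq0 : P7_formula P1 P2 P4 != 0)
  (P7E : (P7 :=: P7_formula P1 P2 P4)%MS)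
  (P3E : (P3 :=: (P1 + P2) :&: (P4 + P7))%MS)
  (P5E : (P5 :=: (P1 + P4) :&: (P2 + P7))%MS)
  (P6E : (P6 :=: (P1 + P7) :&: (P2 + P4))%MS) :
  [/\ C8_configuration P1 P2 P3 P4 P5 P6 P7,
      exists f : {mpoly K[3]},
        [/\ cubic f,
            forall P, P \in [:: P1; P2; P3; P4; P5; P6; P7] -> eigenpoint f P
          & forall g : {mpoly K[3]}, cubic g ->
              (forall P, P \in [:: P1; P2; P3; P4; P5; P6; P7] ->
                 eigenpoint g P) ->
              exists2 c : K, c != 0 & g = c *: f]
    & [/\ dot (cross P1 P2) (cross P3 P4) = 0,
          dot (cross P1 P4) (cross P2 P5) = 0
        & dot (cross P1 P6) (cross P2 P4) = 0]].
Proof.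
have /and5P[P1n P2n P3n P4n /and4P[P5n P6n P7n _]] := points.
have [P3l P3r] : (P3 <= P1 + P2)%MS /\ (P3 <= P4 + P7)%MS.
  by rewrite !P3E capmxSl capmxSr.
have [P5l P5r] : (P5 <= P1 + P4)%MS /\ (P5 <= P2 + P7)%MS.
  by rewrite !P5E capmxSl capmxSr.
have [P6l P6r] : (P6 <= P1 + P7)%MS /\ (P6 <= P2 + P4)%MS.
  by rewrite !P6E capmxSl capmxSr.
have abc : dot (cross P1 P2) P4 != 0.
  by apply/eqP => abc0; apply: not_aligned; apply: dot_cross_eq0_aligned.
(* Dividing by D keeps the point and normalises the three dot products of n with the basis. *)
pose D := dot (cross P1 P2) P4; pose n := D^-1 *: P7_formula P1 P2 P4.
have D0 : D != 0 by [].
have [na nb nc] : [/\ dot n P1 = dot P1 P2 * dot P1 P4,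
    dot n P2 = dot P1 P2 * dot P2 P4 & dot n P4 = dot P1 P4 * dot P2 P4].
  by have [e1 e2 e4] := dot_P7_formula P1 P2 P4; split;
    rewrite dotZl ?e1 ?e2 ?e4 mulKf.
have n0 : n != 0 by rewrite /n scaler_eq0 invr_eq0 (negbTE D0).
have P7n' : (P7 <= n)%MS by rewrite P7E /n eqmx_scale ?invr_eq0.
have /sub_rVP [k7 P7k] := P7n'.
have [al [be [ga nE]]] := row_decomp n abc.
have acb := det_swap abc.
have bca : dot (cross P2 P4) P1 != 0 by rewrite -dot_cross_rot.
have [k3 k30 P3k] := meet_point abc P3n nE P3l
  (submx_trans P3r (addsmxS (submx_refl _) P7n')).
have nE5 : n = al *: P1 + ga *: P4 + be *: P2 by rewrite nE addrAC.
have [k5 k50 P5k] := meet_point acb P5n nE5 P5l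
  (submx_trans P5r (addsmxS (submx_refl _) P7n')).
have nE6 : n = be *: P2 + ga *: P4 + al *: P1 by rewrite nE -addrA addrC.
have [k6 k60 P6k] := meet_point bca P6n nE6 P6r
  (submx_trans P6l (addsmxS (submx_refl _) P7n')).
(* Since P3, P5 and P6 are nonzero, at most one coordinate of n vanishes; [coord_neq0] then excludes
   that single zero. *)
have ab0 : (al != 0) || (be != 0).
  rewrite -negb_and; apply: contraNN P3n => /andP[/eqP z1 /eqP z2].
  by rewrite P3k z1 z2 !scale0r addr0 scaler0.
have ag0 : (al != 0) || (ga != 0).
  rewrite -negb_and; apply: contraNN P5n => /andP[/eqP z1 /eqP z2].
  by rewrite P5k z1 z2 !scale0r addr0 scaler0.
have bg0 : (be != 0) || (ga != 0).
  rewrite -negb_and; apply: contraNN P6n => /andP[/eqP z1 /eqP z2].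
  by rewrite P6k z1 z2 !scale0r addr0 scaler0.
have al0 : al != 0.
  apply/negP => /eqP z; move: ab0 ag0; rewrite z eqxx /= => be0 ga0.
  suff : al != 0 by rewrite z eqxx.
  by apply: (coord_neq0 bca nE6 _ _ _ n0 be0 ga0);
    rewrite ?na ?nb ?nc ?(dotC P2 P1) ?(dotC P4 P1) // mulrC.
have be0 : be != 0.
  apply/negP => /eqP z; move: bg0; rewrite z eqxx /= => ga0.
  suff : be != 0 by rewrite z eqxx.
  by apply: (coord_neq0 acb nE5 _ _ _ n0 al0 ga0);
    rewrite ?na ?nb ?nc ?(dotC P4 P2) // mulrC.
have ga0 : ga != 0 by apply: (coord_neq0 abc nE na nb nc n0).
have [na' [nb' nc']] := (na, (nb, nc)); rewrite nE in na' nb' nc'.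
have eigen k := c8_cubic_eigenpoints abc na' nb' nc' al0 be0 ga0 k.
split.
- split; split.
  + by apply: (@aligned_sub _ _ _ P1 P2); rewrite !addsmx_sub addsmxSl addsmxSr.
  + by apply: (@aligned_sub _ _ _ P1 P4); rewrite !addsmx_sub addsmxSl addsmxSr.
  + by apply: (@aligned_sub _ _ _ P1 P7);
    rewrite !addsmx_sub addsmxSl addsmxSr P6l.
  + by apply: (@aligned_sub _ _ _ P2 P4); rewrite !addsmx_sub addsmxSl addsmxSr.
  + by apply: (@aligned_sub _ _ _ P2 P7);
    rewrite !addsmx_sub addsmxSl addsmxSr P5r.
  + by apply: (@aligned_sub _ _ _ P4 P7);
    rewrite !addsmx_sub addsmxSl addsmxSr P3r.
- have fE P : P \in [:: P1; P2; P3; P4; P5; P6; P7] ->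
      eigenpoint (c8_cubic P1 P2 P4) P.
    rewrite !inE => /or4P[/eqP ->|/eqP ->|/eqP ->|/or4P[]/eqP ->].
    + by have [[H _ _] _ _] := eigen 1; rewrite scale1r in H; apply: H.
    + by have [[_ H _] _ _] := eigen 1; rewrite scale1r in H; apply: H.
    + by have [_ [H _ _] _] := eigen k3; rewrite -P3k in H; apply: H.
    + by have [[_ _ H] _ _] := eigen 1; rewrite scale1r in H; apply: H.
    + by have [_ [_ H _] _] := eigen k5; rewrite -P5k in H; apply: H.
    + by have [_ [_ _ H] _] := eigen k6; rewrite -P6k in H; apply: H.
    + by have [_ _ H] := eigen k7; rewrite -nE -P7k in H; apply: H.
  have hf := c8_cubic_homog P1 P2 P4.
  have f0 := c8_cubic_neq0 abc P7_neq0.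
  have [u [v [w det]]] :=
    c8_eigencubic_determined abc P7_neq0 na' nb' nc' al0 be0 ga0.
  have ev h : h \is 3.-homog ->
      (forall P, P \in [:: P1; P2; P3; P4; P5; P6; P7] -> eigenpoint h P) ->
      forall P, P \in [:: P1; P2; P4; al *: P1 + be *: P2; al *: P1 + ga *: P4;
        be *: P2 + ga *: P4] -> exists m, eigenvector h P m.
    move=> hh hP.
    have hV P : P \in [:: P1; P2; P3; P4; P5; P6; P7] ->
        exists m, eigenvector h P m.
      move=> Pin; apply/eigenpoint_eigenvector => //; last exact: hP.
      exact: (allP points).
    move=> P; rewrite !inE => /or3P[/eqP ->|/eqP ->|/or4P[]/eqP ->].
    + by apply: hV; rewrite !inE eqxx.
    + by apply: hV; rewrite !inE eqxx ?orbT.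
    + by apply: hV; rewrite !inE eqxx ?orbT.
    + by apply: (eigenvector_scale k30); rewrite -P3k; apply: hV;
      rewrite !inE eqxx ?orbT.
    + by apply: (eigenvector_scale k50); rewrite -P5k; apply: hV;
      rewrite !inE eqxx ?orbT.
    + by apply: (eigenvector_scale k60); rewrite -P6k; apply: hV;
      rewrite !inE eqxx ?orbT.
  exists (c8_cubic P1 P2 P4); split=> // g [g0 hg] gP.
  (* The functional is injective on eigencubics, so it is nonzero on this cubic, and k is chosen to
     make it vanish on g - k f. *)
  have fuvw : polar (c8_cubic P1 P2 P4) u v w != 0.
    by apply: contraNneq f0 => f0; rewrite (det _ hf (ev _ hf fE) f0).
  pose k := polar g u v w / polar (c8_cubic P1 P2 P4) u v w.
  have gk : g = k *: c8_cubic P1 P2 P4.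
    apply/eqP; rewrite -subr_eq0; apply/eqP; apply: det.
    + by rewrite rpredB // dhomogZ.
    + by move=> P Pin; apply: eigenvector_sub; apply: ev Pin.
    + by rewrite polar_sub /k divfK // subrr.
  exists k => //; apply: contraNneq g0 => k0.
  by rewrite gk k0 scale0r.
(* After the Binet-Cauchy identity, each claim combines two of the relations for n so that the
   right-hand sides cancel, as do the terms of the basis vector missing from the point. *)
- rewrite !dot_cross_cross P3k P5k P6k.
  move: na' nb' nc'; rewrite !(dotDl, dotZl, dotDr, dotZr).
  rewrite (dotC P2 P1) (dotC P4 P1) (dotC P4 P2) => na' nb' nc'; split.
  + by move: (congr2 +%R (congr1 ( *%R (k3 * dot P2 P4)) na')
      (congr1 ( *%R (- k3 * dot P1 P4)) nb')) => /eq_of_subr_eq; apply; ring.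
  + by move: (congr2 +%R (congr1 ( *%R (k5 * dot P1 P2)) nc')
      (congr1 ( *%R (- k5 * dot P2 P4)) na')) => /eq_of_subr_eq; apply; ring.
  + by move: (congr2 +%R (congr1 ( *%R (k6 * dot P1 P2)) nc')
      (congr1 ( *%R (- k6 * dot P1 P4)) nb')) => /eq_of_subr_eq; apply; ring.
Qed.

End Main.

Theorem proposition7p9 (R : realType) (P1 P2 P3 P4 P5 P6 P7 : 'rV[R[i]]_3)
  (points : all (fun P => P != 0) [:: P1; P2; P3; P4; P5; P6; P7])
  (not_aligned : ~ aligned P1 P2 P4)
  (P7_neq0 : P7_formula P1 P2 P4 != 0)
  (P7E : (P7 :=: P7_formula P1 P2 P4)%MS)
  (P71 : ~ (P7 :=: P1)%MS) (P72 : ~ (P7 :=: P2)%MS) (P74 : ~ (P7 :=: P4)%MS)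
  (P3E : (P3 :=: (P1 + P2) :&: (P4 + P7))%MS)
  (P5E : (P5 :=: (P1 + P4) :&: (P2 + P7))%MS)
  (P6E : (P6 :=: (P1 + P7) :&: (P2 + P4))%MS) :
  [/\ C8_configuration P1 P2 P3 P4 P5 P6 P7,
      exists f : {mpoly R[i][3]},
        [/\ cubic f,
            forall P, P \in [:: P1; P2; P3; P4; P5; P6; P7] -> eigenpoint f P
          & forall g : {mpoly R[i][3]}, cubic g ->
              (forall P, P \in [:: P1; P2; P3; P4; P5; P6; P7] ->
                 eigenpoint g P) ->
              exists2 c : R[i], c != 0 & g = c *: f]
    & [/\ dot (cross P1 P2) (cross P3 P4) = 0,
          dot (cross P1 P4) (cross P2 P5) = 0
        & dot (cross P1 P6) (cross P2 P4) = 0]].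
Proof. exact: c8_eigencubic P7E P3E P5E P6E. Qed.
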